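(* Let $k$ be an algebraically closed field of characteristic zero and let $v$ be an algebraic vector field on an abelian variety $A$ over $k$. Then $v$ is wild if and only if $(A,v)$ admits no nontrivial rational first integrals.
   Context: An algebraic vector field on a variety $X$ over $k$ is a global regular section $v:X\to TX$ of the tangent space, equivalently a $k$-linear derivation of $\mathcal{O}_X$; it induces a derivation $\delta_v$ on the rational function field $k(X)$ when $X$ is irreducible. A nontrivial rational first integral of $(X,v)$ is an element $f\in k(X)\setminus k$ with $\delta_v(f)=0$. A Zariski closed subset $Y\subseteq X$ (with reduced structure, possibly reducible) is invariant for $(X,v)$ if $v|_Y$ maps $Y$ into $TY$; equivalently, the ideal sheaf of $Y$ is preserved by the derivation. The vector field $v$ is wild if there is no nonempty closed subset $Y\subsetneq X$ that is invariant for $(X,v)$. *)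

(* Defs.v *)
(* Varieties over an algebraically closed field k are treated classically: a
   variety is its set of k-points, with its Zariski topology and its sheaf of
   k-valued regular functions, and it may be reducible. *)
From HB Require Import structures.
From mathcomp Require Import all_boot all_order all_algebra.
From mathcomp Require Import generic_quotient mpoly.
From mathcomp Require Import boolp classical_sets topology_structure.

Set Implicit Arguments.
Unset Strict Implicit.
Unset Printing Implicit Defensive.
Import GRing.Theory.
Local Open Scope classical_set_scope.
Local Open Scope ring_scope.
Local Open Scope quotient_scope.

(* [regular x f] says that f is a regular function on some open neighbourhood
   of x; its values elsewhere are irrelevant.  The sections of the structure
   sheaf over an open set U are the functions f with [regular_on U f], taken
   up to equality on U; the sheaf condition then holds by construction. *)
Record fspace (k : fieldType) := FSpace {
  carrier :> topologicalType;
  regular : carrier -> (carrier -> k) -> Prop;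
  regular_near : forall x f, regular x f -> \forall y \near x, regular y f;
  regular_germ : forall x f g,
    (\forall y \near x, f y = g y) -> regular x f -> regular x g;
  regular_cst : forall x (c : k), regular x (fun=> c);
  regular_add : forall x f g,
    regular x f -> regular x g -> regular x (fun y => f y + g y);
  regular_mul : forall x f g,
    regular x f -> regular x g -> regular x (fun y => f y * g y)
}.

Definition regular_on (k : fieldType) (X : fspace k) (U : set X) (f : X -> k) :=
  forall x, U x -> regular x f.

Definition is_morphism (k : fieldType) (X Y : fspace k) (f : X -> Y) :=
  continuous f /\
  forall (x : X) (g : Y -> k), regular (f x) g -> regular x (g \o f).

Definition zeros (k : fieldType) (n : nat) (S : set {mpoly k[n]}) :
  set ('I_n -> k) := [set a | forall p, S p -> p.@[a] = 0].

(* The open subspace U is isomorphic, through phi, to the closed algebraic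
   subset [zeros S] of k^n with its Zariski topology and its regular functions,
   which are those that are locally quotients of polynomials. *)
Definition affine_chart (k : fieldType) (X : fspace k) (U : set X) (n : nat)
    (S : set {mpoly k[n]}) (phi : X -> 'I_n -> k) :=
  [/\ {in U &, injective phi},
      phi @` U = zeros S,
      forall W : set X, W `<=` U ->
        (open W <-> exists T : set {mpoly k[n]}, W = U `\` phi @^-1` zeros T)
    & forall (x : X) (f : X -> k), U x ->
        (regular x f <-> exists p q : {mpoly k[n]}, q.@[phi x] != 0 /\
           forall y, U y -> q.@[phi y] != 0 -> f y = p.@[phi y] / q.@[phi y])].

Definition affine_open (k : fieldType) (X : fspace k) (U : set X) :=
  open U /\ exists (n : nat) (S : set {mpoly k[n]}) (phi : X -> 'I_n -> k),
    affine_chart U S phi.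

Definition prevariety (k : fieldType) (X : fspace k) :=
  exists (m : nat) (U : 'I_m -> set X),
    (forall i, affine_open (U i)) /\ \bigcup_i U i = setT.

(* The product X * Y in the category of spaces with functions.  The library's
   product topology is not the Zariski one, whence the copy [zprod] of the
   type X * Y. *)
Section Product.
Variables (k : fieldType) (X Y : fspace k).

Definition zprod : Type := (X * Y)%type.
HB.instance Definition _ := Choice.on zprod.

(* h is in the image of the tensor product of O(U) and O(V) *)
Definition tensor (U : set X) (V : set Y) (h : zprod -> k) :=
  exists (I : finType) (f : I -> X -> k) (g : I -> Y -> k),
    [/\ forall i, regular_on U (f i), forall i, regular_on V (g i)
      & forall x y, U x -> V y -> h (x, y) = \sum_i f i x * g i y].

(* The basic open sets of the product are the nonvanishing loci in U * V of
   the elements of the tensor product of O(U) and O(V). *)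
Definition basic (B : set zprod) := exists (U : set X) (V : set Y) h,
  [/\ open U, open V, tensor U V h & B = [set p | [/\ U p.1, V p.2 & h p != 0]]].

Definition zprod_open (W : set zprod) :=
  forall p, W p -> exists B, [/\ basic B, B p & B `<=` W].

Lemma regular_on_sub (Z : fspace k) (U V : set Z) (f : Z -> k) :
  V `<=` U -> regular_on U f -> regular_on V f.
Proof. by move=> VU Uf x /VU /Uf. Qed.

Lemma tensor_sub (U U' : set X) (V V' : set Y) h :
  U' `<=` U -> V' `<=` V -> tensor U V h -> tensor U' V' h.
Proof.
move=> sU sV [I [f [g [Uf Vg hE]]]]; exists I, f, g; split.
- by move=> i; apply: regular_on_sub (Uf i).
- by move=> i; apply: regular_on_sub (Vg i).
- by move=> x y /sU Ux /sV Vy; exact: hE.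
Qed.

Lemma tensor_cst U V (c : k) : tensor U V (fun=> c).
Proof.
exists unit, (fun _ _ => c), (fun _ _ => 1); split.
- by move=> _ x _; exact: regular_cst.
- by move=> _ x _; exact: regular_cst.
- by move=> x y _ _; rewrite big_const card_unit /= mulr1 addr0.
Qed.

Lemma tensor_add U V h h' :
  tensor U V h -> tensor U V h' -> tensor U V (fun p => h p + h' p).
Proof.
move=> [I [f [g [Uf Vg hE]]]] [I' [f' [g' [Uf' Vg' hE']]]].
exists (I + I')%type,
  (fun i => match i with inl i => f i | inr i => f' i end),
  (fun i => match i with inl i => g i | inr i => g' i end); split.
- by case.
- by case.
- by move=> x y Ux Vy; rewrite hE // hE' // big_sumType.
Qed.

Lemma tensor_mul U V h h' :
  tensor U V h -> tensor U V h' -> tensor U V (fun p => h p * h' p).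
Proof.
move=> [I [f [g [Uf Vg hE]]]] [I' [f' [g' [Uf' Vg' hE']]]].
exists (I * I')%type, (fun i x => f i.1 x * f' i.2 x),
  (fun i y => g i.1 y * g' i.2 y); split.
- by move=> i x Ux; apply: regular_mul; [exact: Uf | exact: Uf'].
- by move=> i y Vy; apply: regular_mul; [exact: Vg | exact: Vg'].
- move=> x y Ux Vy; rewrite hE // hE' // big_distrlr /= pair_big /=.
  by apply: eq_bigr => i _; rewrite mulrACA.
Qed.

Lemma basicI B B' : basic B -> basic B' -> basic (B `&` B').
Proof.
move=> [U [V [h [oU oV th ->]]]] [U' [V' [h' [oU' oV' th' ->]]]].
exists (U `&` U'), (V `&` V'), (fun p => h p * h' p); split.
- exact: openI.
- exact: openI.
- by apply: tensor_mul; [apply: tensor_sub th | apply: tensor_sub th'];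
    move=> ? [].
- apply/seteqP; split=> p /=.
    by move=> [[Up Vp hp] [Up' Vp' hp']]; rewrite mulf_neq0.
  by rewrite mulf_eq0 negb_or => -[[? ?] [? ?] /andP[]].
Qed.

Lemma zprod_openT : zprod_open setT.
Proof.
move=> p _; exists setT; split=> //; exists setT, setT, (fun=> 1); split.
- exact: openT.
- exact: openT.
- exact: tensor_cst.
- by apply/seteqP; split=> // q _ /=; rewrite oner_neq0.
Qed.

Lemma zprod_openI : setI_closed zprod_open.
Proof.
move=> W W' oW oW' p [/oW [B [bB Bp sB]] /oW' [B' [bB' Bp' sB']]].
exists (B `&` B'); split=> //; first exact: basicI.
by move=> q [/sB ? /sB' ?].
Qed.

Lemma zprod_open_bigU (I : Type) (F : I -> set zprod) :
  (forall i, zprod_open (F i)) -> zprod_open (\bigcup_i F i).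
Proof.
move=> oF p [i _ /oF [B [bB Bp sB]]]; exists B; split=> // q /sB Fq.
by exists i.
Qed.

HB.instance Definition _ :=
  isOpenTopological.Build zprod zprod_openT zprod_openI zprod_open_bigU.

Lemma zprod_openE (W : set zprod) : open W = zprod_open W.
Proof. by []. Qed.

Lemma basic_open B : basic B -> open B.
Proof. by move=> bB; rewrite zprod_openE => p Bp; exists B; split. Qed.

Definition zprod_regular (p : zprod) (F : zprod -> k) :=
  exists (U : set X) (V : set Y) (h d : zprod -> k),
    [/\ open U /\ open V, tensor U V h /\ tensor U V d,
        [/\ U p.1, V p.2 & d p != 0]
      & forall q, U q.1 -> V q.2 -> d q != 0 -> F q = h q / d q].

Lemma zprod_regular_near p F :
  zprod_regular p F -> \forall q \near p, zprod_regular q F.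
Proof.
move=> [U [V [h [d [[oU oV] [th td] pE FE]]]]].
apply: (@filterS _ _ _ [set q : zprod | [/\ U q.1, V q.2 & d q != 0]]).
  by move=> q qE; exists U, V, h, d; split.
by apply: open_nbhs_nbhs; split=> //; apply: basic_open; exists U, V, d; split.
Qed.

Lemma zprod_regular_germ p F G :
  (\forall q \near p, F q = G q) -> zprod_regular p F -> zprod_regular p G.
Proof.
rewrite /prop_near1 nbhsE => -[W [oW Wp] WE] [U [V [h [d [[oU oV] [th td] [Up Vp dp] FE]]]]].
rewrite zprod_openE in oW.
have [B [[U' [V' [e [oU' oV' te BE]]]] Bp sB]] := oW p Wp.
move: Bp; rewrite BE => -[Up' Vp' ep].
exists (U `&` U'), (V `&` V'), (fun q => h q * e q), (fun q => d q * e q).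
split.
- by split; exact: openI.
- by split; apply: tensor_mul;
    [apply: tensor_sub th | apply: tensor_sub te
    |apply: tensor_sub td | apply: tensor_sub te]; move=> ? [].
- by split=> //; rewrite mulf_neq0.
- move=> q [Uq Uq'] [Vq Vq']; rewrite mulf_eq0 negb_or => /andP[dq eq].
  rewrite -WE; last by apply: sB; rewrite BE; split.
  by rewrite FE // -mulf_div divff // mulr1.
Qed.

Lemma zprod_regular_cst p (c : k) : zprod_regular p (fun=> c).
Proof.
exists setT, setT, (fun=> c), (fun=> 1); split.
- by split; exact: openT.
- by split; exact: tensor_cst.
- by split=> //; exact: oner_neq0.
- by move=> q _ _ _; rewrite divr1.
Qed.

Lemma zprod_regular_op p F G (op : (k -> k -> k))
    (num : k -> k -> k -> k -> k) :
  (forall U V h d h' d', tensor U V h -> tensor U V d -> tensor U V h' ->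
     tensor U V d' -> tensor U V (fun q => num (h q) (d q) (h' q) (d' q))) ->
  (forall a b a' b', b != 0 -> b' != 0 ->
     op (a / b) (a' / b') = num a b a' b' / (b * b')) ->
  zprod_regular p F -> zprod_regular p G ->
  zprod_regular p (fun q => op (F q) (G q)).
Proof.
move=> tnum opE [U [V [h [d [[oU oV] [th td] [Up Vp dp] FE]]]]].
move=> [U' [V' [h' [d' [[oU' oV'] [th' td'] [Up' Vp' dp'] GE]]]]].
have sub e : tensor U V e -> tensor (U `&` U') (V `&` V') e.
  by apply: tensor_sub => ? [].
have sub' e : tensor U' V' e -> tensor (U `&` U') (V `&` V') e.
  by apply: tensor_sub => ? [].
exists (U `&` U'), (V `&` V'), (fun q => num (h q) (d q) (h' q) (d' q)),
  (fun q => d q * d' q); split.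
- by split; exact: openI.
- split; first by apply: tnum; [exact: sub|exact: sub|exact: sub'|exact: sub'].
  by apply: tensor_mul; [exact: sub|exact: sub'].
- by split=> //; rewrite mulf_neq0.
- move=> q [Uq Uq'] [Vq Vq']; rewrite mulf_eq0 negb_or => /andP[dq dq'].
  by rewrite FE // GE // opE.
Qed.

Lemma zprod_regular_add p F G : zprod_regular p F -> zprod_regular p G ->
  zprod_regular p (fun q => F q + G q).
Proof.
apply: (@zprod_regular_op _ _ _ _ (fun a b a' b' => a * b' + a' * b)).
  by move=> *; apply: tensor_add; exact: tensor_mul.
by move=> a b a' b' b0 b0'; rewrite addf_div.
Qed.

Lemma zprod_regular_mul p F G : zprod_regular p F -> zprod_regular p G ->
  zprod_regular p (fun q => F q * G q).
Proof.
apply: (@zprod_regular_op _ _ _ _ (fun a b a' b' => a * a')).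
  by move=> *; exact: tensor_mul.
by move=> a b a' b' b0 b0'; rewrite mulf_div.
Qed.

Definition prod_fspace : fspace k :=
  FSpace zprod_regular_near zprod_regular_germ zprod_regular_cst
    zprod_regular_add zprod_regular_mul.

End Product.

Record variety (k : fieldType) := Variety {
  variety_space :> fspace k;
  variety_prevariety : prevariety variety_space;
  variety_separated :
    closed [set p : prod_fspace variety_space variety_space | p.1 = p.2]
}.

Definition complete_variety (k : fieldType) (X : variety k) :=
  forall (Y : variety k) (Z : set (prod_fspace X Y)),
    closed Z -> closed [set p.2 | p in Z].

Record ivariety (k : fieldType) := IVariety {
  ivariety_variety :> variety k;
  ivariety_nonempty : [set: ivariety_variety] !=set0;
  ivariety_irreducible : forall F G : set ivariety_variety,
    closed F -> closed G -> F `|` G = setT -> F = setT \/ G = setT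
}.

(* Commutativity of the group law is a theorem, not part of the definition. *)
Record abelian_variety (k : fieldType) := AbelianVariety {
  av_variety :> ivariety k;
  av_complete : complete_variety av_variety;
  av_add : av_variety -> av_variety -> av_variety;
  av_zero : av_variety;
  av_opp : av_variety -> av_variety;
  av_addA : associative av_add;
  av_add0 : left_id av_zero av_add;
  av_addN : left_inverse av_zero av_opp av_add;
  av_add_morphism :
    @is_morphism k (prod_fspace av_variety av_variety) av_variety
      (fun p => av_add p.1 p.2);
  av_opp_morphism : @is_morphism k av_variety av_variety av_opp
}.

(* A k-linear derivation of the structure sheaf: on an open set U it sends a
   section f of O_X to [v f], whose value at x depends only on the germ of f at
   x.  Equivalently, f |-> v f x is a tangent vector at x, and this section of
   the tangent space is regular.  Only the values [v f x] with f regular at x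
   are meaningful. *)
Record vector_field (k : fieldType) (X : fspace k) := VectorField {
  vf_fun :> (X -> k) -> X -> k;
  vf_regular : forall x f, regular x f -> regular x (vf_fun f);
  vf_germ : forall x f g, regular x f -> (\forall y \near x, f y = g y) ->
    vf_fun f x = vf_fun g x;
  vf_linear : forall x (c : k) f g, regular x f -> regular x g ->
    vf_fun (fun y => c * f y + g y) x = c * vf_fun f x + vf_fun g x;
  vf_leibniz : forall x f g, regular x f -> regular x g ->
    vf_fun (fun y => f y * g y) x = f x * vf_fun g x + g x * vf_fun f x
}.

(* v preserves the ideal sheaf of functions vanishing on Y. *)
Definition invariant (k : fieldType) (X : fspace k) (v : vector_field X)
    (Y : set X) :=
  forall (U : set X) (f : X -> k), open U -> regular_on U f ->
    (forall y, U y -> Y y -> f y = 0) ->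
    forall y, U y -> Y y -> v f y = 0.

Definition wild (k : fieldType) (X : fspace k) (v : vector_field X) :=
  ~ exists Y : set X, [/\ closed Y, Y !=set0, Y != setT & invariant v Y].

Section FunctionField.
Variables (k : fieldType) (X : ivariety k).

Record ratfrac := RatFrac {
  dom : set X;
  ratval : X -> k;
  dom_open : open dom;
  dom_nonempty : dom !=set0;
  ratval_regular : regular_on dom ratval
}.

HB.instance Definition _ := gen_eqMixin ratfrac.
HB.instance Definition _ := gen_choiceMixin ratfrac.

Lemma ivariety_openI (U V : set X) :
  open U -> open V -> U !=set0 -> V !=set0 -> U `&` V !=set0.
Proof.
move=> oU oV [x Ux] [y Vy]; apply: contrapT => /set0P/negP; rewrite negbK.
move=> /eqP UV0.
have : ~` U `|` ~` V = setT by rewrite -setCI UV0 setC0.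
move=> /(ivariety_irreducible (open_closedC oU) (open_closedC oV)) [UE|VE].
  by have : (~` U) x by rewrite UE.
by have : (~` V) y by rewrite VE.
Qed.

Definition rateq (f g : ratfrac) : bool :=
  `[< exists W, [/\ open W, W !=set0, W `<=` dom f `&` dom g
      & forall x, W x -> ratval f x = ratval g x] >].

Lemma rateq_refl : reflexive rateq.
Proof.
move=> f; apply/asboolP; exists (dom f); split=> //.
- exact: dom_open.
- exact: dom_nonempty.
Qed.

Lemma rateq_sym : ssrbool.symmetric rateq.
Proof.
suff H f g : rateq f g -> rateq g f by move=> f g; apply/idP/idP; exact: H.
move=> /asboolP[W [oW W0 sW E]]; apply/asboolP; exists W; split=> //.
- by rewrite setIC.
- by move=> x /E.
Qed.

Lemma rateq_trans : transitive rateq.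
Proof.
move=> g f h /asboolP[W [oW W0 sW E]] /asboolP[W' [oW' W0' sW' E']].
apply/asboolP; exists (W `&` W'); split.
- exact: openI.
- exact: ivariety_openI.
- by move=> x [/sW[? _] /sW'[_ ?]].
- by move=> x [/E -> /E' ->].
Qed.

Canonical rateq_equiv := EquivRel rateq rateq_refl rateq_sym rateq_trans.

(* The rational function field k(X), as the direct limit of the O(U) over the
   nonempty open sets U. *)
Definition ratfun := {eq_quot rateq_equiv}.

Definition ratfrac_cst (c : k) : ratfrac :=
  RatFrac openT (ivariety_nonempty X) (fun x _ => regular_cst x c).

Definition ratfun_cst (c : k) : ratfun := \pi_ratfun (ratfrac_cst c).

Variable v : vector_field X.

Definition ratfrac_der (f : ratfrac) : ratfrac :=
  RatFrac (dom_open f) (dom_nonempty f)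
    (fun x fx => vf_regular v (ratval_regular fx)).

(* The derivation of k(X) induced by v; see [ratfun_derE]. *)
Definition ratfun_der (f : ratfun) : ratfun := \pi_ratfun (ratfrac_der (repr f)).

Lemma ratfun_derE (f : ratfrac) :
  ratfun_der (\pi_ratfun f) = \pi_ratfun (ratfrac_der f).
Proof.
have /eqmodP/asboolP[W [oW W0 sW E]] : repr (\pi_ratfun f) = f %[mod ratfun].
  by rewrite reprK.
apply/eqmodP/asboolP; exists W; split=> // x Wx /=; apply: vf_germ.
  by apply: ratval_regular; have [] := sW x Wx.
by apply: filterS E _; exact: open_nbhs_nbhs.
Qed.

Definition first_integral (f : ratfun) := ratfun_der f = ratfun_cst 0.

Definition nontrivial_first_integral (f : ratfun) :=
  (forall c : k, f <> ratfun_cst c) /\ first_integral f.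

End FunctionField.

(* Main.v *)
Require Import Defs.
From mathcomp Require Import all_boot all_order all_algebra.
From HB Require Import structures.
From mathcomp Require Import generic_quotient mpoly zify.
From mathcomp Require Import boolp classical_sets topology_structure.

(* If Y is a closed invariant set, consider the tensors h(t, x) of regular
   functions on rectangles that vanish where t + x lies in Y.  A global vector
   field on A is translation-invariant, because v(f(- x + .))(x) is a regular
   function of x on a complete variety; hence v, acting on the second variable,
   preserves these tensors.  If v has no nontrivial first integral, Artin's
   shortest relation argument shows that they are all 0.  But the complement of
   {(t, x) : t + x in Y} is open, so that when Y is proper it contains a nonempty
   basic open set, which yields a nonzero such tensor.

   Conversely, the closure of a level set f = c of a first integral is invariant.
   At a point y of it, the functions all of whose iterated derivatives vanish at
   y form a prime ideal (in characteristic 0), which contains f - c; by the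
   Nullstellensatz, a function outside this ideal cannot vanish on the level set
   near y. *)

Set Implicit Arguments.
Unset Strict Implicit.
Unset Printing Implicit Defensive.
Import GRing.Theory.
Local Open Scope classical_set_scope.
Local Open Scope ring_scope.

(** * The Nullstellensatz for prime ideals *)

(** The unit ideal is allowed, so that preimages stay prime without a side condition; properness
    comes from a given element outside [P]. *)
Record prime_ideal (R : comNzRingType) (P : set R) : Prop := PrimeIdeal {
  prime0 : P 0;
  primeD : forall x y, P x -> P y -> P (x + y);
  primeM : forall x y, P y -> P (x * y);
  primeMP : forall x y, P (x * y) -> P x \/ P y }.

Lemma primeMr (R : comNzRingType) (P : set R) :
  prime_ideal P -> forall x y, P x -> P (x * y).
Proof. by move=> pP x y Px; rewrite mulrC; apply: primeM. Qed.

Lemma primeN (R : comNzRingType) (P : set R) x :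
  prime_ideal P -> P x -> P (- x).
Proof. by move=> pP Px; rewrite -mulN1r; apply: primeM. Qed.

Lemma primeX (R : comNzRingType) (P : set R) x n :
  prime_ideal P -> ~ P 1 -> P (x ^+ n) -> P x.
Proof.
move=> pP P1; elim: n => [|n IHn]; first by rewrite expr0.
by rewrite exprS => /(primeMP pP)[].
Qed.

Lemma size_min_exists (R : nzSemiRingType) (Q : set {poly R}) : Q !=set0 ->
  exists2 p, Q p & forall q, Q q -> (size p <= size q)%N.
Proof.
move=> [p Qp].
have exQ : exists n, `[< exists2 q, Q q & size q = n >].
  by exists (size p); apply/asboolP; exists p.
case: (ex_minnP exQ) => m /asboolP[r Qr sr] minm; exists r => // s Qs.
by rewrite sr; apply: minm; apply/asboolP; exists s.
Qed.

Section PrimeStep.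
Variables (R : idomainType) (P : set {poly R}).
Hypothesis pP : prime_ideal P.

(** The extension to [R[X]] of the contraction of [P] to [R]: these polynomials become 0 over the
    residue ring of the contraction. *)
Definition coefs_in (p : {poly R}) := forall i, P (p`_i)%:P.

Lemma coefs_inW p : coefs_in p -> P p.
Proof.
move=> Np; rewrite -[p]coefK poly_def.
apply: (big_ind P) => [||i _]; [exact: (prime0 pP) | exact: (primeD pP) |].
by rewrite -mul_polyC; apply: (primeMr pP).
Qed.

Lemma primeZ (c : R) p : ~ P c%:P -> P (c *: p) -> P p.
Proof. by move=> Pc; rewrite -mul_polyC => /(primeMP pP)[]. Qed.

(* A polynomial of minimal size among those of [J] with some coefficient
   outside [P]: its leading term cannot be subtracted. *)
Lemma min_lead (J : set {poly R}) :
  P `<=` J -> (forall p q, J p -> J q -> J (p + q)) ->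
  (exists2 p, J p & ~ coefs_in p) ->
  exists g, [/\ J g, ~ P (lead_coef g)%:P
    & forall q, J q -> (size q < size g)%N -> coefs_in q].
Proof.
move=> PJ JD [p0 Jp0 Np0].
have [|g [Jg Ng] ming] := @size_min_exists R [set p | J p /\ ~ coefs_in p].
  by exists p0.
have small q : J q -> (size q < size g)%N -> coefs_in q.
  move=> Jq; rewrite ltnNge => /negP sq; apply: contrapT => Nq.
  by apply: sq; apply: ming.
exists g; split=> // Pl; apply: Ng.
have [->|g0] := eqVneq g 0; first by move=> i; rewrite coef0; exact: (prime0 pP).
set m := (size g).-1; pose t := lead_coef g *: 'X^m.
have sg : size g = m.+1 by rewrite /m prednK // lt0n size_poly_eq0.
have Nt : coefs_in t.
  move=> i; rewrite coefZ coefXn polyCM.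
  by apply: (primeMr pP).
have Nr : coefs_in (g - t).
  apply: small.
    by apply: JD => //; apply: PJ; apply: (primeN pP) => //; exact: coefs_inW.
  rewrite sg ltnS; apply/leq_sizeP => j mj; rewrite coefB coefZ coefXn.
  have [->|jm] := eqVneq j m; first by rewrite /= mulr1n mulr1 lead_coefE subrr.
  rewrite mulr0 subr0 nth_default // sg ltn_neqAle eq_sym jm //.
by move=> i; rewrite -[g](subrK t) coefD polyCD; apply: (primeD pP).
Qed.

(* The residue ring of [P] is generated by one element over the residue ring of
   its contraction to [R]; outside the zeros of [c], the points of the latter
   lift. *)
Lemma prime_point_step (h : {poly R}) : ~ P h ->
  exists2 c : R, ~ P c%:P &
    forall (k : closedFieldType) (phi : {rmorphism R -> k}),
      (forall r, P r%:P -> phi r = 0) -> phi c != 0 ->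
      exists2 b, forall p, P p -> (map_poly phi p).[b] = 0
               & (map_poly phi h).[b] != 0.
Proof.
move=> Ph; have Nh : ~ coefs_in h by move/coefs_inW.
have map0 (k : closedFieldType) (phi : {rmorphism R -> k}) p :
    (forall r, P r%:P -> phi r = 0) -> coefs_in p -> map_poly phi p = 0.
  by move=> phiP Np; apply/polyP => i; rewrite coef_map coef0 /= phiP.
(* If [P] is the extension of its contraction, a coefficient of [h] outside [P] serves as [c], and
   any non-root of the image of [h] as [b]. *)
have [[p Pp Np]|NP] := pselect (exists2 p, P p & ~ coefs_in p); last first.
  move: Nh => /existsNP[i Phi]; exists h`_i => // k phi phiP hi.
  have /closed_nonrootP[b hb] : map_poly phi h != 0.
    by apply: contraNneq hi => /polyP/(_ i); rewrite coef_map coef0 => ->.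
  exists b => // q Pq; rewrite (map0 _ _ _ phiP) ?horner0 //.
  by apply: contrapT => Nq; apply: NP; exists q.
have P1 : ~ P 1 by move=> P1; apply: Ph; rewrite -[h]mulr1; apply: (primeM pP).
have PX (x : R) n : ~ P x%:P -> ~ P (x ^+ n)%:P.
  by move=> Px; rewrite polyC_exp => /(primeX pP P1).
(* Over the fraction field of the residue ring of the contraction, [g] is, up to a scalar, the
   minimal polynomial of the class of ['X]. *)
have [g [Pg Pl ming]] : exists g, [/\ P g, ~ P (lead_coef g)%:P
    & forall q, P q -> (size q < size g)%N -> coefs_in q].
  by apply: min_lead => //; [exact: (primeD pP) | exists p].
(* The ideal generated by [P] and [h]. Its minimal element [w] turns out to be a constant, so that
   [h] divides a nonzero constant modulo [P]. *)
pose J := [set q | exists u, P (q - u * h)].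
have PJ : P `<=` J by move=> q Pq; exists 0; rewrite mul0r subr0.
have Jh : J h by exists 1; rewrite mul1r subrr; apply: (prime0 pP).
have JD q q' : J q -> J q' -> J (q + q').
  move=> [u Pu] [u' Pu']; exists (u + u').
  by rewrite mulrDl opprD addrACA; apply: (primeD pP).
have JM q q' : J q' -> J (q * q').
  by move=> [u Pu]; exists (q * u); rewrite -mulrA -mulrBr; apply: (primeM pP).
have [w [Jw Pw minw]] : exists w, [/\ J w, ~ P (lead_coef w)%:P
    & forall q, J q -> (size q < size w)%N -> coefs_in q].
  by apply: min_lead => //; exists h.
have nz q : ~ P (lead_coef q)%:P -> q != 0.
  move=> Pq; apply/eqP => q0; apply: Pq; rewrite q0 lead_coef0.
  exact: (prime0 pP).
(* Pseudo-division: the remainder stays in [J] and is too small to have a coefficient outside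
   [P]. *)
have rem q : J q -> P (q %% w).
  move=> Jq; apply/coefs_inW/minw; last by rewrite ltn_modpN0 // nz.
  have -> : q %% w = lead_coef w ^+ scalp q w *: q + (- (q %/ w)) * w.
    by rewrite Pdiv.Idomain.divp_eq mulNr addrAC subrr add0r.
  by apply: JD; [rewrite -mul_polyC |]; apply: JM.
have Pw' : ~ P w.
  move=> PPw; apply: Ph; apply: (@primeZ (lead_coef w ^+ scalp h w)).
    exact: PX.
  rewrite Pdiv.Idomain.divp_eq; apply: (primeD pP); last exact: rem.
  exact: (primeM pP).
(* Otherwise the quotient of [g] by [w] lies in [P] and is smaller than [g], so its coefficients are
   in [P]; then so are those of [g] times a power of [lead_coef w], against the choice of [g]. *)
have sw : size w = 1%N.
  apply/eqP; rewrite eqn_leq lt0n size_poly_eq0 nz // andbT leqNgt; apply/negP => sw.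
  have : P (g %/ w * w).
    rewrite -[_ * _](addrK (g %% w)) -Pdiv.Idomain.divp_eq -mul_polyC.
    apply: (primeD pP); first exact: (primeM pP).
    by apply: (primeN pP) => //; apply: rem; exact: PJ.
  move=> /(primeMP pP)[Pq|//].
  have g0 : (0 < size g)%N by rewrite lt0n size_poly_eq0 nz.
  have Nq : coefs_in (g %/ w).
    apply: ming => //; rewrite Pdiv.Idomain.size_divp ?nz // ltn_subrL g0 andbT.
    by rewrite -ltnS prednK // lt0n size_poly_eq0 nz.
  have Ng : coefs_in (lead_coef w ^+ scalp g w *: g).
    move=> i; rewrite Pdiv.Idomain.divp_eq coefD polyCD.
    apply: (primeD pP); last first.
      apply: minw; last by rewrite ltn_modpN0 // nz.
      by apply: (PJ); apply: rem; exact: PJ.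
    rewrite coefM rmorph_sum; apply: (big_ind P) => [||j _].
    - exact: (prime0 pP).
    - exact: (primeD pP).
    - by rewrite /= polyCM; apply: (primeMr pP); exact: Nq.
  have := Ng (size g).-1; rewrite coefZ polyCM => /(primeMP pP)[|//].
  exact: PX.
have [u Pwu] := Jw.
have wE : w = (lead_coef w)%:P by rewrite lead_coefE sw -size1_polyC // sw.
(* The factor [lead_coef g] preserves the size of [g] under [phi], which gives a root [b]; the
   factor [lead_coef w], congruent to [u * h] modulo [P], keeps [h] nonzero at [b]. *)
exists (lead_coef w * lead_coef g).
  by rewrite polyCM => /(primeMP pP)[].
move=> k phi phiP; rewrite rmorphM mulf_eq0 negb_or => /andP[phiw phig].
have sg : size (map_poly phi g) = size g by rewrite size_map_poly_id0.
have /closed_rootP[b /eqP gb] : size (map_poly phi g) != 1.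
  rewrite sg; apply/eqP => sg1; apply: Pl.
  by rewrite lead_coefE sg1 -size1_polyC // sg1.
have zb p' : P p' -> (map_poly phi p').[b] = 0.
  move=> Pp'; have Nr : coefs_in (p' %% g).
    apply: ming; last by rewrite ltn_modpN0 // nz.
    have -> : p' %% g = lead_coef g ^+ scalp p' g *: p' + (- (p' %/ g)) * g.
      by rewrite Pdiv.Idomain.divp_eq mulNr addrAC subrr add0r.
    by apply: (primeD pP); [rewrite -mul_polyC |]; apply: (primeM pP).
  have := congr1 (fun q => (map_poly phi q).[b]) (Pdiv.Idomain.divp_eq p' g).
  rewrite map_polyZ rmorphD rmorphM /= (map0 _ _ _ phiP Nr) addr0 !hornerE gb.
  rewrite mulr0 => /eqP; rewrite mulf_eq0 rmorphXn expf_eq0 (negPf phig) andbF.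
  by move/eqP.
exists b => //; apply: contraNneq phiw => hb.
have := zb _ Pwu; rewrite rmorphB rmorphM /= !hornerE hb mulr0 subr0.
by rewrite {1}wE map_polyC hornerC => ->.
Qed.
End PrimeStep.

Lemma mpoly_rmorph_ext (k S : comNzRingType) (n : nat)
    (f g : {rmorphism {mpoly k[n]} -> S}) :
  (forall c, f c%:MP = g c%:MP) -> (forall i, f 'X_i = g 'X_i) -> f =1 g.
Proof.
move=> fgC fgX p; rewrite [p]mpolyE !rmorph_sum; apply: eq_bigr => m _.
rewrite -mul_mpolyC !rmorphM fgC mpolyXE_id !rmorph_prod; congr (_ * _).
by apply: eq_bigr => i _; rewrite !rmorphXn /= fgX.
Qed.

(** * Splitting off the last variable of a polynomial *)

Section Univariate.
Variables (k : comNzRingType) (n : nat).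

Definition uni_var (i : 'I_n.+1) : {poly {mpoly k[n]}} :=
  if unlift ord_max i is Some j then ('X_j)%:P else 'X.

Definition uni : {mpoly k[n.+1]} -> {poly {mpoly k[n]}} :=
  mmap (polyC \o @mpolyC n k) uni_var.

Definition widen_mp : {mpoly k[n]} -> {mpoly k[n.+1]} :=
  mmap (@mpolyC n.+1 k) (fun j => 'X_(lift ord_max j)).

Definition multi (p : {poly {mpoly k[n]}}) : {mpoly k[n.+1]} :=
  (map_poly widen_mp p).['X_ord_max].

HB.instance Definition _ := GRing.RMorphism.on uni.
HB.instance Definition _ := GRing.RMorphism.on widen_mp.

Lemma multi_is_rmorphism :
  exists f : {rmorphism {poly {mpoly k[n]}} -> {mpoly k[n.+1]}}, multi = f.
Proof. by exists (horner_eval 'X_ord_max \o map_poly widen_mp). Qed.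

Lemma uniK : cancel uni multi.
Proof.
pose f : {rmorphism {mpoly k[n.+1]} -> {mpoly k[n.+1]}} :=
  horner_eval 'X_ord_max \o map_poly widen_mp \o uni.
apply: (@mpoly_rmorph_ext _ _ _ f idfun) => [c|i] /=.
  by rewrite /uni mmapC /= map_polyC /= /horner_eval hornerC /widen_mp mmapC.
rewrite /uni mmapX mmap1U /uni_var /horner_eval; case: unliftP => [j|] ->.
  by rewrite map_polyC hornerC /= /widen_mp mmapX mmap1U.
by rewrite map_polyX hornerX.
Qed.

Definition extend_point (a : 'I_n -> k) (b : k) (i : 'I_n.+1) : k :=
  if unlift ord_max i is Some j then a j else b.

Lemma meval_extend (a : 'I_n -> k) b p :
  p.@[extend_point a b] = (map_poly (meval a) (uni p)).[b].
Proof.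
pose f : {rmorphism {mpoly k[n.+1]} -> k} :=
  horner_eval b \o map_poly (meval a) \o uni.
apply: (@mpoly_rmorph_ext _ _ _ (meval (extend_point a b)) f) => [c|i] /=.
  by rewrite mevalC /uni mmapC /= map_polyC /= /horner_eval hornerC mevalC.
rewrite mevalXU /uni mmapX mmap1U /uni_var /extend_point /horner_eval.
case: unliftP => [j|] _; first by rewrite map_polyC hornerC /= mevalXU.
by rewrite map_polyX hornerX.
Qed.
End Univariate.

Lemma prime_preimage (R S : comNzRingType) (f : {rmorphism R -> S}) (P : set S) :
  prime_ideal P -> prime_ideal (f @^-1` P).
Proof.
move=> pP; split=> [|x y|x y|x y]; rewrite /preimage /= ?rmorph0 ?rmorphD ?rmorphM.
- exact: (prime0 pP).
- exact: (primeD pP).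
- exact: (primeM pP).
- exact: (primeMP pP).
Qed.

(** Induction on the number of variables: the contraction of [P] to the polynomials without the last
    variable has a zero where the [c] of [prime_point_step] survives, and that lemma supplies the
    last coordinate. *)
Lemma prime_nullstellensatz (k : closedFieldType) n (P : set {mpoly k[n]}) h :
  prime_ideal P -> ~ P h ->
  exists2 a : 'I_n -> k, zeros P a & h.@[a] != 0.
Proof.
elim: n P h => [|n IHn] P h pP Ph.
  have cst (p : {mpoly k[0]}) : p = (p.@[fun=> 0])%:MP.
    pose f : {rmorphism {mpoly k[0]} -> {mpoly k[0]}} :=
      @mpolyC 0 k \o meval (fun=> 0).
    suff: idfun p = f p by [].
    apply: mpoly_rmorph_ext => [c|[]//].
    by rewrite /= mevalC.
  exists (fun=> 0) => [p Pp|]; last first.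
    by apply/eqP => h0; apply: Ph; rewrite [h]cst h0 mpolyC0; exact: (prime0 pP).
  (* Without variables [p] is a scalar; a nonzero one would be a unit in [P], which would then
     contain [h]. *)
  apply: contrapT => /eqP p0; apply: Ph.
  rewrite -[h]mulr1 -mpolyC1 -(mulVf p0) mpolyCM -cst.
  by do 2! apply: (primeM pP).
have [f multiE] := multi_is_rmorphism k n.
have PfE p : P (f (uni p)) = P p by rewrite -multiE uniK.
have pQ := prime_preimage f pP.
have [|c Pc liftc] := prime_point_step pQ (h := uni h).
  by rewrite /preimage /= PfE.
have pI := prime_preimage (@polyC {mpoly k[n]}) pQ.
have [a aI ac] := IHn _ c pI Pc.
have [//|b bP bh] := liftc k (meval a) _ ac.
exists (extend_point a b); last by rewrite meval_extend.
by move=> p Pp; rewrite meval_extend bP // /preimage /= PfE.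
Qed.

(** * Morphisms of spaces with functions *)

Section Local.
Variables (k : fieldType) (X : fspace k).
Implicit Types (x : X) (f g : X -> k) (U : set X).

Lemma regular_ext x f g : f =1 g -> regular x f -> regular x g.
Proof. by move=> fg; apply: regular_germ; apply: nearW. Qed.

Lemma regular_sum x (I : Type) (r : seq I) (F : I -> X -> k) :
  (forall i, regular x (F i)) -> regular x (fun y => \sum_(i <- r) F i y).
Proof.
move=> rF; elim: r => [|i r IHr].
  by apply: regular_ext (regular_cst x 0) => y; rewrite big_nil.
apply: regular_ext (regular_add (rF i) IHr) => y.
by rewrite big_cons.
Qed.

Lemma regular_scale x c f : regular x f -> regular x (fun y => c * f y).
Proof. by apply: regular_mul; exact: regular_cst. Qed.

Lemma regular_sub x f g :
  regular x f -> regular x g -> regular x (fun y => f y - g y).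
Proof.
move=> rf rg; apply: regular_ext (regular_add rf (regular_scale (-1) rg)) => y.
by rewrite mulN1r.
Qed.

Lemma regular_nbhs x f : regular x f ->
  exists U, [/\ open U, U x & regular_on U f].
Proof.
by move=> /regular_near; rewrite /prop_near1 nbhsE => -[U [oU Ux] sU]; exists U.
Qed.

(** The condition that makes the stalks local rings; it is not among the axioms of [fspace] and is
    proved below for prevarieties and for products. *)
Definition local_space := forall x f, regular x f -> f x != 0 ->
  (\forall y \near x, f y != 0) /\ regular x (fun y => (f y)^-1).

Lemma open_neq0 U f : local_space -> open U -> regular_on U f ->
  open [set x | U x /\ f x != 0].
Proof.
move=> locX oU rf; rewrite openE => x [Ux fx].
have [nf _] := locX _ _ (rf _ Ux) fx.
by apply: filterI => //; exact: open_nbhs_nbhs.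
Qed.
End Local.

Lemma prevariety_local (k : fieldType) (X : fspace k) :
  prevariety X -> local_space X.
Proof.
move=> [m [U [affU covU]]] x f rf fx.
have [i _ Ux] : (\bigcup_i U i) x by rewrite covU.
have [oU [n [S [phi [_ _ openU regU]]]]] := affU i.
have [p [q [qx fE]]] := (regU x f Ux).1 rf.
have px : p.@[phi x] != 0.
  by apply: contraNneq fx => p0; rewrite fE // p0 mul0r.
split.
  have oW : open (U i `\` phi @^-1` zeros [set p * q]).
    by apply/openU; [exact: subDsetl | exists [set p * q]].
  apply: (@filterS _ _ _ (U i `\` phi @^-1` zeros [set p * q])).
    move=> y [Uy pqy]; have : (p * q).@[phi y] != 0.
      by apply: contra_notN pqy => /eqP e _ ->.
    rewrite mevalM mulf_eq0 negb_or => /andP[py qy].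
    by rewrite fE // mulf_neq0 // invr_eq0.
  apply: open_nbhs_nbhs; split=> //; split=> // /(_ _ erefl)/eqP.
  by rewrite mevalM mulf_eq0 (negPf px) (negPf qx).
apply/(regU _ _ Ux); exists (q * q), (p * q).
rewrite mevalM mulf_neq0 //; split=> // y Uy.
rewrite !mevalM mulf_eq0 negb_or => /andP[py qy].
by rewrite fE // invf_div -mulf_div divff // mulr1.
Qed.

Lemma zprod_local (k : fieldType) (X Y : fspace k) :
  local_space (prod_fspace X Y).
Proof.
move=> x f [U [V [h [d [[oU oV] [th td] [Ux Vx dx] fE]]]]] fx.
have hx : h x != 0.
  by apply: contraNneq fx => h0; rewrite fE // h0 mul0r.
have thd := tensor_mul th td.
split.
  apply: (@filterS _ _ _ [set q : zprod X Y | [/\ U q.1, V q.2 & h q * d q != 0]]).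
    move=> q [Uq Vq]; rewrite mulf_eq0 negb_or => /andP[hq dq].
    by rewrite fE // mulf_neq0 // invr_eq0.
  apply: open_nbhs_nbhs; split.
    by apply: basic_open; exists U, V, (fun q => h q * d q).
  by split=> //; rewrite mulf_neq0.
exists U, V, (fun q => d q * d q), (fun q => h q * d q); split=> //.
- by split=> //; apply: tensor_mul.
- by split=> //; rewrite mulf_neq0.
move=> q Uq Vq; rewrite mulf_eq0 negb_or => /andP[hq dq].
by rewrite fE // invf_div -mulf_div divff // mulr1.
Qed.

Section Morphisms.
Variable k : fieldType.

Lemma morphism_comp (X Y Z : fspace k) (f : X -> Y) (g : Y -> Z) :
  is_morphism f -> is_morphism g -> is_morphism (g \o f).
Proof.
move=> [/continuousP cf rf] [/continuousP cg rg]; split.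
  by apply/continuousP => A /cg/cf.
by move=> x h /rg/rf.
Qed.

Lemma morphism_cst (X Y : fspace k) (y : Y) : is_morphism (fun _ : X => y).
Proof.
split; first exact: cst_continuous.
by move=> x g _; exact: regular_cst.
Qed.

Lemma morphism_id (X : fspace k) : is_morphism (fun x : X => x).
Proof. by split=> // x; exact: cvg_id. Qed.

Lemma tensor_fst (X Y : fspace k) (U : set X) (V : set Y) f :
  regular_on U f -> tensor U V (fun p => f p.1).
Proof.
move=> rf; exists unit, (fun _ => f), (fun _ _ => 1); split=> //.
- by move=> _ y _; exact: regular_cst.
- by move=> x y _ _; rewrite big_const card_unit /= mulr1 addr0.
Qed.

Lemma tensor_snd (X Y : fspace k) (U : set X) (V : set Y) g :
  regular_on V g -> tensor U V (fun p => g p.2).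
Proof.
move=> rg; exists unit, (fun _ _ => 1), (fun _ => g); split=> //.
- by move=> _ x _; exact: regular_cst.
- by move=> x y _ _; rewrite big_const card_unit /= mul1r addr0.
Qed.

Lemma open_rect (X Y : fspace k) (U : set X) (V : set Y) : open U -> open V ->
  open [set p : prod_fspace X Y | U p.1 /\ V p.2].
Proof.
move=> oU oV; apply: basic_open; exists U, V, (fun=> 1).
split=> //; first exact: tensor_cst.
by apply/seteqP; split=> p /= [Up Vp]; split=> //; rewrite oner_neq0.
Qed.

Lemma tensor_regular (X Y : fspace k) (U : set X) (V : set Y) h
    (p : prod_fspace X Y) :
  open U -> open V -> tensor U V h -> U p.1 -> V p.2 -> regular p h.
Proof.
move=> oU oV th Up Vp; exists U, V, h, (fun=> 1); split=> //.
- by split=> //; exact: tensor_cst.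
- by split=> //; exact: oner_neq0.
- by move=> q _ _ _; rewrite divr1.
Qed.

Lemma morphism_fst (X Y : fspace k) : is_morphism (fun p : prod_fspace X Y => p.1).
Proof.
split.
  apply/continuousP => U oU.
  rewrite (_ : _ @^-1` _ = [set p : prod_fspace X Y | U p.1 /\ [set: Y] p.2]).
    by apply: open_rect => //; exact: openT.
  by apply/seteqP; split=> // p [].
move=> p g /regular_nbhs[U [oU Up rg]].
apply: (tensor_regular oU openT) => //.
exact: (tensor_fst _ rg).
Qed.

Lemma morphism_snd (X Y : fspace k) : is_morphism (fun p : prod_fspace X Y => p.2).
Proof.
split.
  apply/continuousP => V oV.
  rewrite (_ : _ @^-1` _ = [set p : prod_fspace X Y | [set: X] p.1 /\ V p.2]).
    by apply: open_rect => //; exact: openT.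
  by apply/seteqP; split=> // p [].
move=> p g /regular_nbhs[V [oV Vp rg]].
apply: (tensor_regular openT oV) => //.
exact: (tensor_snd _ rg).
Qed.

Lemma morphism_open (X Y : fspace k) (f : X -> Y) U :
  is_morphism f -> open U -> open (f @^-1` U).
Proof. by move=> [/continuousP cf _]; exact: cf. Qed.

(** The universal property of the product; [local_space X] inverts the pulled back denominators. *)
Lemma morphism_pair (X Y Z : fspace k) (f : X -> Y) (g : X -> Z) :
  local_space X -> is_morphism f -> is_morphism g ->
  is_morphism (fun x => (f x, g x) : prod_fspace Y Z).
Proof.
move=> locX mf mg.
have reg U V h x : open U -> open V -> tensor U V h -> U (f x) -> V (g x) ->
    regular x (fun x => h (f x, g x)).
  move=> oU oV [I [a [b [ra rb hE]]]] Ux Vx.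
  apply: (@regular_germ _ _ _ (fun x => \sum_i a i (f x) * b i (g x))).
    apply: (@filterS _ _ _ (f @^-1` U `&` g @^-1` V)).
      by move=> y [Uy Vy]; rewrite hE.
    by apply: open_nbhs_nbhs; split=> //; apply: openI; exact: morphism_open.
  apply: regular_sum => i; apply: regular_mul.
    by apply: mf.2; exact: ra.
  by apply: mg.2; exact: rb.
split.
  apply/continuousP => W; rewrite zprod_openE openE => oW x.
  move=> /oW[B [[U [V [h [oU oV th BE]]]]]].
  rewrite BE => -[Ux Vx hx] sW.
  have [nh _] := locX _ _ (reg _ _ _ _ oU oV th Ux Vx) hx.
  apply: (@filterS _ _ _
    ([set x | h (f x, g x) != 0] `&` (f @^-1` U `&` g @^-1` V))).
    by move=> y [hy [Uy Vy]]; apply: sW.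
  apply: filterI => //; apply: open_nbhs_nbhs; split=> //.
  by apply: openI; exact: morphism_open.
move=> x F [U [V [h [d [[oU oV] [th td] [Ux Vx dx] FE]]]]].
have rh := reg _ _ _ _ oU oV th Ux Vx.
have [nd rd] := locX _ _ (reg _ _ _ _ oU oV td Ux Vx) dx.
apply: regular_germ (regular_mul rh rd).
apply: (@filterS _ _ _ ([set x | d (f x, g x) != 0] `&` (f @^-1` U `&` g @^-1` V))).
  by move=> y [dy [Uy Vy]]; rewrite /= FE.
apply: filterI => //; apply: open_nbhs_nbhs; split=> //.
by apply: openI; exact: morphism_open.
Qed.

End Morphisms.

(** * Iterated derivatives *)

Section VectorField.
Variables (k : fieldType) (X : fspace k) (v : vector_field X).
Implicit Types (x : X) (f g : X -> k) (U : set X).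

Lemma vf_ext x f g : regular x f -> f =1 g -> v f x = v g x.
Proof. by move=> rf fg; apply: vf_germ => //; apply: nearW. Qed.

Lemma vf_cst x c : v (fun=> c) x = 0.
Proof.
have r c' := regular_cst x c'.
have v1 : v (fun=> 1) x = 0.
  have := vf_leibniz v (r 1) (r 1).
  have -> : (fun y : X => (fun=> 1) y * (fun=> 1) y) = (fun=> 1 : k).
    by apply: funext => y; rewrite mulr1.
  by rewrite mul1r -[LHS]addr0 => /addrI <-.
have v0 : v (fun=> 0) x = 0.
  have := vf_linear v 1 (r 0) (r 0).
  have -> : (fun y : X => 1 * (fun=> 0) y + (fun=> 0) y) = (fun=> 0 : k).
    by apply: funext => y; rewrite mulr0 addr0.
  by rewrite mul1r -[LHS]addr0 => /addrI <-.
have := vf_linear v c (r 1) (r 0).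
have -> : (fun y : X => c * (fun=> 1) y + (fun=> 0) y) = (fun=> c).
  by apply: funext => y; rewrite mulr1 addr0.
by rewrite v1 v0 mulr0 addr0.
Qed.

Lemma vf_add x f g : regular x f -> regular x g ->
  v (fun y => f y + g y) x = v f x + v g x.
Proof.
move=> rf rg; have := vf_linear v 1 rf rg; rewrite mul1r => <-.
by apply: vf_ext => [|y]; [exact: regular_add | rewrite mul1r].
Qed.

Lemma vf_sum x (I : Type) (r : seq I) (c : I -> k) (F : I -> X -> k) :
  (forall i, regular x (F i)) ->
  v (fun y => \sum_(i <- r) c i * F i y) x = \sum_(i <- r) c i * v (F i) x.
Proof.
move=> rF; elim: r => [|i r IHr].
  rewrite big_nil -[RHS](vf_cst x 0); apply: esym; apply: vf_ext => [|y].
    exact: regular_cst.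
  by rewrite big_nil.
have rS : regular x (fun y => \sum_(i <- r) c i * F i y).
  by apply: regular_sum => j; exact: regular_scale.
rewrite big_cons -IHr -vf_linear //; apply: esym; apply: vf_ext => [|y].
  by apply: regular_add => //; exact: regular_scale.
by rewrite big_cons.
Qed.

Lemma iter_regular n x f : regular x f -> regular x (iter n v f).
Proof. by move=> rf; elim: n => //= n; exact: vf_regular. Qed.

Lemma iter_germ n x f g : regular x f -> (\forall y \near x, f y = g y) ->
  iter n v f x = iter n v g x.
Proof.
(* Applying [v] once more uses equality of germs, so the induction carries equality near [x]. *)
move=> rf fg; suff : \forall y \near x, iter n v f y = iter n v g y.
  exact: nbhs_singleton.
elim: n => [//|n IHn] /=.
apply: filterS (filterI (regular_near (iter_regular n rf)) (nbhs_interior IHn)).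
by move=> y [ry ny]; apply: vf_germ.
Qed.

Lemma iter_cst0 n x : iter n v (fun=> 0) x = 0.
Proof.
elim: n x => // n IHn x; rewrite iterSr -[RHS](IHn x).
by congr (iter n v _ x); apply: funext => y; rewrite vf_cst.
Qed.

Lemma iter_add n x f g : regular x f -> regular x g ->
  iter n v (fun y => f y + g y) x = iter n v f x + iter n v g x.
Proof.
elim: n f g => // n IHn f g rf rg; rewrite !iterSr -IHn; last 2 first.
- exact: vf_regular.
- exact: vf_regular.
apply: iter_germ; first by apply: vf_regular; exact: regular_add.
apply: filterS (filterI (regular_near rf) (regular_near rg)) => y [rfy rgy].
exact: vf_add.
Qed.

(** The general Leibniz rule: expand the innermost derivative, then use Pascal's rule. *)
Lemma iter_leibniz n x f g : regular x f -> regular x g ->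
  iter n v (fun y => f y * g y) x =
  \sum_(i < n.+1) iter i v f x * iter (n - i) v g x *+ 'C(n, i).
Proof.
elim: n f g => [|n IHn] f g rf rg; first by rewrite big_ord1.
have rvf := vf_regular v rf; have rvg := vf_regular v rg.
rewrite iterSr.
transitivity (iter n v (fun y => f y * v g y + v f y * g y) x).
  apply: iter_germ; first by apply: vf_regular; exact: regular_mul.
  apply: filterS (filterI (regular_near rf) (regular_near rg)) => y [rfy rgy].
  by rewrite vf_leibniz // [g y * _]mulrC.
rewrite iter_add; [|exact: regular_mul..].
rewrite !IHn // [RHS]big_ord_recl /= bin0.
under [X in _ = _ + X]eq_bigr => i _ do rewrite binS mulrnDr /bump /= add1n subSS.
rewrite big_split /= addrA; congr (_ + _); last first.
  by apply: eq_bigr => i _; rewrite -iterSr.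
rewrite [in RHS]big_ord_recr /= bin_small // mulr0n addr0.
rewrite big_ord_recl /= bin0 -iterSr /=; rewrite subn0; congr (_ + _).
by apply: eq_bigr => i _; rewrite /bump /= add1n -iterSr subnSK.
Qed.

Hypothesis char0 : [pchar k] =i pred0.

(** If [m] and [n] are the least orders of a nonzero derivative of [f] and [g], a single term of the
    Leibniz formula of order [m + n] survives, and its binomial coefficient is nonzero in
    characteristic 0. *)
Lemma iter_mul_neq0 x f g : regular x f -> regular x g ->
  (exists n, iter n v f x != 0) -> (exists n, iter n v g x != 0) ->
  exists n, iter n v (fun y => f y * g y) x != 0.
Proof.
move=> rf rg exf exg; exists (ex_minn exf + ex_minn exg)%N.
case: ex_minnP => m fm minm; case: ex_minnP => n gn minn.
rewrite iter_leibniz //.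
have lm : (m < (m + n).+1)%N by rewrite ltnS leq_addr.
rewrite (bigD1 (Ordinal lm)) //= big1 ?addr0 => [|i /eqP im].
  rewrite addKn -mulr_natr !mulf_neq0 //.
  by rewrite ((pcharf0P k).1 char0) -lt0n bin_gt0 leq_addr.
have [lt_im|le_mi] := ltnP i m.
  suff /eqP -> : iter i v f x == 0 by rewrite mul0r mul0rn.
  by apply: contraTT lt_im; rewrite -leqNgt; exact: minm.
suff /eqP -> : iter (m + n - i) v g x == 0 by rewrite mulr0 mul0rn.
suff : (m + n - i < n)%N by apply: contraTT; rewrite -leqNgt; exact: minn.
have : (m < i)%N.
  by rewrite ltn_neqAle le_mi andbT; apply/eqP => e; apply: im; exact/val_inj.
by move=> mi; have := ltn_ord i; lia.
Qed.
End VectorField.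

(** * Level sets of first integrals *)

Section LevelSet.
Variables (k : closedFieldType) (X : fspace k) (v : vector_field X).
Hypothesis char0 : [pchar k] =i pred0.

Lemma iter_constant_germ n x (f : X -> k) : regular x f -> f x = 0 ->
  (\forall y \near x, v f y = 0) -> iter n v f x = 0.
Proof.
case: n => [//|n] rf fx vf0; rewrite iterSr -(iter_cst0 v n x).
by apply: iter_germ => //; exact: vf_regular.
Qed.

(* The polynomials in the coordinates [phi] that vanish on the formal integral
   curve of [v] through [y]. *)
Lemma orbit_ideal_prime n (phi : X -> 'I_n -> k) y :
  (forall p : {mpoly k[n]}, regular y (fun z => p.@[phi z])) ->
  prime_ideal
    [set p : {mpoly k[n]} | forall m, iter m v (fun z => p.@[phi z]) y = 0].
Proof.
move=> rphi; split=> [m|p q Pp Pq m|p q Pq m|p q Ppq] /=.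
- rewrite -(iter_cst0 v m y); congr (iter m v _ y).
  by apply: funext => z; rewrite meval0.
- rewrite -[RHS](addr0 0) -{1}(Pp m) -(Pq m) -iter_add //; congr (iter m v _ y).
  by apply: funext => z; rewrite mevalD.
- transitivity (iter m v (fun z => p.@[phi z] * q.@[phi z]) y).
    by congr (iter m v _ y); apply: funext => z; rewrite mevalM.
  by rewrite iter_leibniz // big1 // => i _; rewrite Pq mulr0 mul0rn.
- apply: contrapT => /not_orP[/existsNP[m /eqP pm] /existsNP[l /eqP ql]].
  have [||j] := @iter_mul_neq0 _ _ v char0 _ _ _ (rphi p) (rphi q).
  - by exists m.
  - by exists l.
  apply/negP; rewrite negbK -(Ppq j); apply/eqP; congr (iter j v _ y).
  by apply: funext => z; rewrite mevalM.
Qed.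

(** If [v g y] were nonzero, the prime ideal [P] of the orbit of [y] would contain the equations of
    the chart and of the level set, but not the numerator of [g]; a zero of [P] would be a point of
    the level set where [g] is nonzero. *)
Lemma invariant_level_set (W : set X) (f : X -> k) (c : k) :
  prevariety X -> open W -> regular_on W f ->
  (forall x, W x -> v f x = 0) -> forall (O : set X) (g : X -> k) y,
  open O -> regular_on O g ->
  (forall x, O x -> W x -> f x = c -> g x = 0) ->
  O y -> W y -> f y = c -> v g y = 0.
Proof.
move=> [m [U [affU covU]]] oW rf vf0 O g y oO rg gO Oy Wy fy.
apply: contrapT => /eqP vgy.
have [i _ Uy] : (\bigcup_i U i) y by rewrite covU.
have [oU [n [S [phi [injphi imphi openU regU]]]]] := affU i.
have [p1 [q1 [q1y fE]]] := (regU y f Uy).1 (rf _ Wy).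
have [p2 [q2 [q2y gE]]] := (regU y g Uy).1 (rg _ Oy).
have rpoly p x : U i x -> regular x (fun z => (p : {mpoly k[n]}).@[phi z]).
  move=> Ux; apply/(regU x _ Ux); exists p, 1; rewrite meval1 oner_neq0.
  by split=> // z _ _; rewrite meval1 divr1.
have near_chart q : q.@[phi y] != 0 -> \forall z \near y, U i z /\ q.@[phi z] != 0.
  move=> qy; have oW' : open (U i `\` phi @^-1` zeros [set q]).
    by apply/openU; [exact: subDsetl | exists [set q]].
  apply: (@filterS _ _ _ (U i `\` phi @^-1` zeros [set q])).
    by move=> z [Uz qz]; split=> //; apply: contra_notN qz => /eqP e _ ->.
  apply: open_nbhs_nbhs; split=> //; split=> // /(_ _ erefl)/eqP.
  by rewrite (negPf qy).
(* Some [t] in [T] is nonzero at [y]; its nonvanishing locus in the chart lies inside [W] and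
   [O]. *)
have [T TE] : exists T, W `&` O `&` U i = U i `\` phi @^-1` zeros T.
  by apply/openU; [exact: subIsetr | do 2! apply: openI => //].
have : (W `&` O `&` U i) y by [].
rewrite TE => -[_ /existsNP[t /not_implyP[Tt /eqP ty]]].
set P := [set p : {mpoly k[n]} | forall m, iter m v (fun z => p.@[phi z]) y = 0].
have pP : prime_ideal P by apply: orbit_ideal_prime => p; exact: rpoly.
have notP p : p.@[phi y] != 0 -> ~ P p by move=> /eqP py /(_ 0%N).
have gy := gO _ Oy Wy fy.
(* Near [y], [p2] is [g * q2]; as [g y = 0], its first derivative at [y] is [q2] times [v g y]. *)
have Pp2 : ~ P p2.
  move=> /(_ 1%N) /=; rewrite (@vf_germ _ _ v _ _ (fun z => g z * q2.@[phi z])) //.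
  - rewrite vf_leibniz //; [|exact: rg|exact: rpoly].
    by rewrite gy mul0r add0r => /eqP; rewrite mulf_eq0 (negPf q2y) (negPf vgy).
  - exact: rpoly.
  - by apply: filterS (near_chart _ q2y) => z [Uz qz]; rewrite gE // divfK.
(* Near [y] this polynomial is [(f - c) * q1], and every iterated derivative of [f - c] vanishes at
   [y]. *)
have Pp1 : P (p1 - c *: q1).
  move=> l; transitivity (iter l v (fun z => (f z - c) * q1.@[phi z]) y).
    apply: iter_germ; first exact: rpoly.
    apply: filterS (near_chart _ q1y) => z [Uz qz].
    by rewrite mevalB mevalZ mulrBl fE // divfK.
  have rfc x : W x -> regular x (fun z => f z - c).
    by move=> Wx; apply: regular_add; [exact: rf | exact: regular_cst].
  rewrite iter_leibniz //; [|exact: rfc|exact: rpoly].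
  rewrite big1 // => j _; rewrite iter_constant_germ ?mul0r ?mul0rn //.
  - exact: rfc.
  - by rewrite fy subrr.
  - apply: (@filterS _ _ _ W); last exact: open_nbhs_nbhs.
    move=> x Wx; rewrite vf_add; [|exact: rf|exact: regular_cst].
    by rewrite vf_cst addr0 vf0.
(* At [a], [t] ensures membership in [W] and [O], [q1] and [q2] keep the fractions for [f] and [g]
   valid, and [p2] makes [g] nonzero. *)
have [|a aP] := prime_nullstellensatz (h := p2 * q1 * q2 * t) pP.
  by move=> /(primeMP pP)[/(primeMP pP)[/(primeMP pP)[//|]|]|]; apply: notP.
rewrite !mevalM !mulf_eq0 !negb_or -!andbA => /and4P[p2a q1a q2a ta].
(* The equations of the chart vanish near [y], hence belong to [P]; so [a] is a point of the
   chart. *)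
have : zeros S a.
  move=> s Ss; apply: aP => l; rewrite -(iter_cst0 v l y); apply: iter_germ.
    exact: rpoly.
  apply: (@filterS _ _ _ (U i)); last exact: open_nbhs_nbhs.
  move=> x Ux; have : zeros S (phi x) by rewrite -imphi; exists x.
  exact.
rewrite -imphi => -[x Ux phix].
have : (U i `\` phi @^-1` zeros T) x.
  by split=> //; rewrite /preimage /= phix => /(_ _ Tt)/eqP; rewrite (negPf ta).
rewrite -TE => -[[Wx Ox] _].
have fx : f x = c.
  have := aP _ Pp1; rewrite mevalB mevalZ fE // phix // => /eqP.
  by rewrite subr_eq0 => /eqP ->; rewrite mulfK.
have := gO _ Ox Wx fx; rewrite gE // phix // => /eqP.
by rewrite mulf_eq0 invr_eq0 (negPf p2a) (negPf q2a).
Qed.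
End LevelSet.

(** * Regular functions on complete varieties *)

Section AffineLine.
Variable k : fieldType.

Definition zline : Type := k.
HB.instance Definition _ := Choice.on zline.

(** One-variable polynomials are taken in [{mpoly k[1]}] to agree with [affine_chart]. *)
Definition eval1 (p : {mpoly k[1]}) (x : k) : k := p.@[fun=> x].

Lemma eval1_1 x : eval1 1 x = 1. Proof. exact: meval1. Qed.
Lemma eval1C c x : eval1 c%:MP x = c. Proof. exact: mevalC. Qed.
Lemma eval1D p q x : eval1 (p + q) x = eval1 p x + eval1 q x.
Proof. exact: mevalD. Qed.
Lemma eval1M p q x : eval1 (p * q) x = eval1 p x * eval1 q x.
Proof. exact: mevalM. Qed.

Definition zline_open (W : set zline) := forall x, W x ->
  exists2 p, eval1 p x != 0 & forall y, eval1 p y != 0 -> W y.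

Lemma zline_openT : zline_open setT.
Proof. by move=> x _; exists 1; rewrite ?eval1_1 ?oner_neq0. Qed.

Lemma zline_openI : setI_closed zline_open.
Proof.
move=> U V oU oV x [/oU[p px pU] /oV[q qx qV]]; exists (p * q).
  by rewrite eval1M mulf_neq0.
by move=> y; rewrite eval1M mulf_eq0 negb_or => /andP[/pU ? /qV].
Qed.

Lemma zline_open_bigU (I : Type) (F : I -> set zline) :
  (forall i, zline_open (F i)) -> zline_open (\bigcup_i F i).
Proof.
move=> oF x [i _ /oF[p px pF]]; exists p => // y /pF Fy.
by exists i.
Qed.

HB.instance Definition _ :=
  isOpenTopological.Build zline zline_openT zline_openI zline_open_bigU.

Lemma zline_openE (W : set zline) : open W = zline_open W.
Proof. by []. Qed.

Lemma zline_open_neq0 p : open [set x : zline | eval1 p x != 0].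
Proof. by rewrite zline_openE => x px; exists p. Qed.

Definition zline_regular (x : zline) (f : zline -> k) :=
  exists p q, eval1 q x != 0 /\
    forall y, eval1 q y != 0 -> f y = eval1 p y / eval1 q y.

Lemma zline_regular_near x f :
  zline_regular x f -> \forall y \near x, zline_regular y f.
Proof.
move=> [p [q [qx fE]]].
apply: (@filterS _ _ _ [set y : zline | eval1 q y != 0]).
  by move=> y qy; exists p, q.
by apply: open_nbhs_nbhs; split=> //; exact: zline_open_neq0.
Qed.

Lemma zline_regular_germ x f g :
  (\forall y \near x, f y = g y) -> zline_regular x f -> zline_regular x g.
Proof.
rewrite /prop_near1 nbhsE => -[W [oW Wx] WE] [p [q [qx fE]]].
rewrite zline_openE in oW; have [e ex eW] := oW x Wx.
exists (p * e), (q * e); rewrite eval1M mulf_neq0 //; split=> // y.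
rewrite !eval1M mulf_eq0 negb_or => /andP[qy ey].
by rewrite -WE; [rewrite fE // -mulf_div divff // mulr1 | exact: eW].
Qed.

Lemma zline_regular_poly x p : zline_regular x (eval1 p).
Proof.
exists p, 1; rewrite eval1_1 oner_neq0; split=> // y _.
by rewrite eval1_1 divr1.
Qed.

Lemma zline_regular_cst x c : zline_regular x (fun=> c).
Proof.
exists c%:MP, 1; rewrite eval1_1 oner_neq0; split=> // y _.
by rewrite eval1_1 eval1C divr1.
Qed.

Lemma zline_regular_add x f g : zline_regular x f -> zline_regular x g ->
  zline_regular x (fun y => f y + g y).
Proof.
move=> [p [q [qx fE]]] [p' [q' [qx' gE]]].
exists (p * q' + p' * q), (q * q'); rewrite eval1M mulf_neq0 //; split=> // y.
rewrite eval1D !eval1M mulf_eq0 negb_or => /andP[qy qy'].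
by rewrite fE // gE // addf_div.
Qed.

Lemma zline_regular_mul x f g : zline_regular x f -> zline_regular x g ->
  zline_regular x (fun y => f y * g y).
Proof.
move=> [p [q [qx fE]]] [p' [q' [qx' gE]]].
exists (p * p'), (q * q'); rewrite eval1M mulf_neq0 //; split=> // y.
rewrite !eval1M mulf_eq0 negb_or => /andP[qy qy'].
by rewrite fE // gE // mulf_div.
Qed.

Definition affine_line : fspace k :=
  FSpace zline_regular_near zline_regular_germ zline_regular_cst
    zline_regular_add zline_regular_mul.

Lemma eval1X x : eval1 'X_ord0 x = x. Proof. exact: mevalXU. Qed.

Lemma affine_line_coord (x : affine_line) : regular x (fun y => y).
Proof.
apply: (@regular_ext _ affine_line x (eval1 'X_ord0)) => [y|].
  exact: eval1X.
exact: zline_regular_poly.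
Qed.

Lemma affine_line_prevariety : prevariety affine_line.
Proof.
exists 1%N, (fun=> setT); split=> [_|]; last first.
  by apply/seteqP; split=> // x _; exists ord0.
split; first exact: openT.
exists 1%N, set0, (fun x _ => x); split.
- by move=> x y _ _ /(congr1 (fun a => a ord0)).
- apply/seteqP; split=> [a _ p []|a _]; exists (a ord0) => //.
  by apply: funext => i; rewrite (ord1 i).
- move=> W _; split.
    rewrite zline_openE => oW.
    (* All polynomials whose nonvanishing locus lies in [W]; these loci cover the open set [W]. *)
    exists [set p | forall y, eval1 p y != 0 -> W y].
    apply/seteqP; split=> x.
      move=> /oW[p px pW]; split=> // Tx.
      by move: px; rewrite [eval1 p x](Tx p pW) eqxx.
    move=> [_ /existsNP[p /not_implyP[pW /eqP px]]]; exact: pW.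
  move=> [T ->]; rewrite zline_openE => x [_ /existsNP[p /not_implyP[Tp /eqP px]]].
  exists p => // y py; split=> // Ty.
  by move: py; rewrite [eval1 p y](Ty p Tp) eqxx.
- move=> x f _; split=> [[p [q [qx fE]]]|[p [q [qx fE]]]]; exists p, q; split=> //.
    by move=> y _; exact: fE.
  by move=> y; exact: fE.
Qed.

Lemma affine_line_separated :
  closed [set p : prod_fspace affine_line affine_line | p.1 = p.2].
Proof.
rewrite -[X in closed X]setCK; apply: open_closedC; apply: basic_open.
exists setT, setT, (fun p => p.1 + -1 * p.2); split=> //; [exact: openT..| |].
  have coord U : @regular_on _ affine_line U (fun y => y).
    by move=> x _; exact: affine_line_coord.
  apply: tensor_add; first exact: (tensor_fst _ (coord _)).
  by apply: tensor_mul; [exact: tensor_cst | exact: (tensor_snd _ (coord _))].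
apply/seteqP; split=> p /=; rewrite mulN1r subr_eq0.
  by move=> /eqP.
by move=> [_ _ /eqP].
Qed.

Definition affine_line_variety : variety k :=
  Variety affine_line_prevariety affine_line_separated.

End AffineLine.

(** The fibres over [s] are finitely many closed sets covering [X], so by irreducibility one of them
    is [X]. *)
Lemma finite_values_constant (k : fieldType) (X : ivariety k) (phi : X -> k)
    (s : seq k) :
  regular_on setT phi -> (forall x, phi x \in s) -> exists c, forall x, phi x = c.
Proof.
move=> rphi; have locX := prevariety_local (variety_prevariety X).
have cl1 c : closed [set x | phi x = c].
  rewrite -[X in closed X]setCK; apply: open_closedC.
  rewrite (_ : ~` _ = [set x | setT x /\ phi x - c != 0]).
    apply: open_neq0 => // [|x _]; first exact: openT.
    by apply: regular_add; [exact: rphi | exact: regular_cst].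
  apply/seteqP; split=> x /=; rewrite subr_eq0; first by move/eqP.
  by move=> [_ /eqP].
have cls (t : seq k) : closed [set x | phi x \in t].
  elim: t => [|c t IHt].
    rewrite (_ : [set x | _] = set0); first exact: closed0.
    by apply/seteqP; split.
  rewrite (_ : [set x | _] = [set x | phi x = c] `|` [set x | phi x \in t]).
    exact: closedU.
  apply/seteqP; split=> x /=; rewrite inE; first by case/orP=> [/eqP|]; [left|right].
  by case=> [->|->]; rewrite ?eqxx ?orbT.
elim: s => [|c s IHs] phis.
  by have [x _] := ivariety_nonempty X; have := phis x.
have [|||E|E] := @ivariety_irreducible _ X [set x | phi x = c] [set x | phi x \in s].
- exact: cl1.
- exact: cls.
- apply/seteqP; split=> // x _ /=.
  by have := phis x; rewrite inE => /orP[/eqP|]; [left|right].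
- exists c => x.
  by have : [set x | phi x = c] x by rewrite E.
- apply: IHs => x.
  by have : [set x | phi x \in s] x by rewrite E.
Qed.

(* The projection to the line of [(phi x - c) s = 1] is closed and misses [0],
   so that [1 / (phi x - c)] takes finitely many values. *)
Lemma complete_regular_constant (k : closedFieldType) (X : ivariety k)
    (phi : X -> k) :
  complete_variety X -> regular_on setT phi -> exists c, forall x, phi x = c.
Proof.
move=> cX rphi; have [x0 _] := ivariety_nonempty X; set c := phi x0.
pose L := affine_line_variety k.
pose h (p : prod_fspace X L) : k := (phi p.1 + - c) * p.2 + -1.
have th : tensor (setT : set X) (setT : set L) h.
  apply: tensor_add; last exact: tensor_cst.
  have coord : regular_on (setT : set L) (fun y => y).
    by move=> x _; exact: affine_line_coord.
  apply: tensor_mul; last exact: (tensor_snd _ coord).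
  by apply: tensor_add; [exact: (tensor_fst _ rphi) | exact: tensor_cst].
have clZ : closed [set p | h p = 0].
  rewrite -[X in closed X]setCK; apply: open_closedC; apply: basic_open.
  exists setT, setT, h; split=> //; [exact: openT..|].
  by apply/seteqP; split=> p /= => [/eqP|[_ _ /eqP]].
have := closed_openC (cX L _ clZ); rewrite zline_openE => /(_ 0)[].
  move=> [[x s] /= + s0]; rewrite /h /= s0 mulr0 add0r => /eqP.
  by rewrite oppr_eq0 oner_eq0.
(* [p] is nonzero at 0 and vanishes on the closed image, so each [1 / (phi x - c)] is one of its
   finitely many roots. *)
move=> p p0 pZ; pose P : {poly k} := mmap polyC (fun=> 'X) p.
have PE s : P.[s] = eval1 p s.
  pose f : {rmorphism {mpoly k[1]} -> k} := horner_eval s \o mmap polyC (fun=> 'X).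
  apply: (mpoly_rmorph_ext (f := f) (g := meval (fun=> s))) => [a|i] /=.
    by rewrite mmapC mevalC /horner_eval hornerC.
  by rewrite mmapX mmap1U mevalXU /horner_eval hornerX.
have [rs PrE] := closed_field_poly_normal P.
apply: (@finite_values_constant _ _ _ (c :: [seq c + r^-1 | r <- rs])) => // x.
have [->|xc] := eqVneq (phi x) c; first exact: mem_head.
have d0 : phi x - c != 0 by rewrite subr_eq0.
rewrite inE (negPf xc) /=; apply/mapP; exists (phi x - c)^-1; last first.
  by rewrite invrK addrC subrK.
have : P.[(phi x - c)^-1] = 0.
  rewrite PE; apply: contrapT => /eqP /pZ; apply.
  exists (x, (phi x - c)^-1) => //=.
  by rewrite /h /= divff // subrr.
have P0 : P != 0 by apply: contraNneq p0 => P0; rewrite -PE P0 horner0.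
move=> /eqP; rewrite PrE hornerZ mulf_eq0 lead_coef_eq0 (negPf P0) /=.
by rewrite -[_ == 0]/(root _ _) root_prod_XsubC.
Qed.

(** * Vector fields on abelian varieties *)

Section Translation.
Variables (k : closedFieldType) (A : abelian_variety k) (v : vector_field A).

Local Notation "x +' y" := (av_add x y) (at level 50, left associativity).
Local Notation "-' x" := (av_opp x) (at level 35, right associativity).
Local Notation o := (av_zero A).

Lemma av_addrN (x : A) : x +' -' x = o.
Proof.
rewrite -[LHS]av_add0 -{1}(av_addN (-' x)) -av_addA [-' x +' _]av_addA.
by rewrite av_addN av_add0 av_addN.
Qed.

Lemma av_addr0 (x : A) : x +' o = x.
Proof. by rewrite -(av_addN x) av_addA av_addrN av_add0. Qed.

Lemma av_addKl (t x : A) : -' t +' (t +' x) = x.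
Proof. by rewrite av_addA av_addN av_add0. Qed.

Lemma av_addNKl (t x : A) : t +' (-' t +' x) = x.
Proof. by rewrite av_addA av_addrN av_add0. Qed.

Let locA : local_space A := prevariety_local (variety_prevariety A).

Lemma morphism_add (X : fspace k) (f g : X -> A) : local_space X ->
  is_morphism f -> is_morphism g -> is_morphism (fun x => f x +' g x).
Proof.
move=> locX mf mg.
exact: morphism_comp (morphism_pair locX mf mg) (av_add_morphism A).
Qed.

Lemma translate_morphism (t : A) : is_morphism (fun x : A => t +' x).
Proof.
by apply: morphism_add => //; [exact: morphism_cst | exact: morphism_id].
Qed.

Lemma translate_regular (t x : A) f :
  regular (t +' x) f -> regular x (fun y => f (t +' y)).
Proof. exact: (translate_morphism t).2. Qed.

(** Differentiating in the first variable and restricting to the diagonal turns the sum of the [a i]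
    times [b i] into the sum of the [b i] times [v (a i)]. *)
Lemma tensor_der_regular (U V : set A) h x : open U -> open V ->
  tensor U V h -> U x -> V x ->
  regular x (fun x => v (fun y => h (y, x)) x).
Proof.
move=> oU oV [I [a [b [ra rb hE]]]] Ux Vx.
apply: (@regular_germ _ _ _ (fun x => \sum_i b i x * v (a i) x)).
  apply: (@filterS _ _ _ (U `&` V)); last first.
    by apply: open_nbhs_nbhs; split=> //; exact: openI.
  move=> z [Uz Vz]; rewrite -vf_sum => [|i]; last exact: ra.
  apply: vf_germ; first by apply: regular_sum => i; apply: regular_scale; exact: ra.
  apply: (@filterS _ _ _ U); last exact: open_nbhs_nbhs.
  by move=> y Uy; rewrite hE //; apply: eq_bigr => i _; rewrite mulrC.
apply: regular_sum => i; apply: regular_mul; first exact: rb.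
by apply: vf_regular; exact: ra.
Qed.

Lemma tensor_slice_regular (U V : set A) h (x y : A) : open U ->
  tensor U V h -> U x -> V y -> regular x (fun z => h (z, y)).
Proof.
move=> oU [I [a [b [ra rb hE]]]] Ux Vy.
apply: (@regular_germ _ _ _ (fun z => \sum_i b i y * a i z)).
  apply: (@filterS _ _ _ U); last exact: open_nbhs_nbhs.
  by move=> z Uz; rewrite hE //; apply: eq_bigr => i _; rewrite mulrC.
by apply: regular_sum => i; apply: regular_scale; exact: ra.
Qed.

(** The value at [x] is the tangent vector [v] at [x], moved to the origin and applied to [f]. It is
    regular in [x], hence constant by completeness. *)
Lemma vf_at_origin_constant (f : A -> k) : regular o f ->
  exists c, forall x, v (fun y => f (-' x +' y)) x = c.
Proof.
move=> rf; apply: complete_regular_constant; first exact: av_complete.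
move=> x _.
pose m (p : prod_fspace A A) := -' p.2 +' p.1.
have mm : is_morphism m.
  apply: morphism_add; [exact: zprod_local | | exact: morphism_fst].
  exact: morphism_comp (@morphism_snd _ _ _) (av_opp_morphism A).
have rF : regular ((x, x) : prod_fspace A A) (f \o m).
  by apply: mm.2; rewrite /m /= av_addN.
have [U [V [h [d [[oU oV] [th td] [/= Ux Vx dx] FE]]]]] := rF.
have mdiag := morphism_pair locA (morphism_id A) (morphism_id A).
have rd : regular x (fun z => d (z, z)).
  by apply: (mdiag.2 x d); apply: (tensor_regular oU oV td).
have [nd rd'] := locA rd dx.
pose H z := v (fun y => h (y, z)) z.
pose D z := v (fun y => d (y, z)) z.
have rH : regular x H by apply: (tensor_der_regular oU oV).
have rD : regular x D by apply: (tensor_der_regular oU oV).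
(* The quotient rule for [h / d] in the first variable, on the diagonal, where the quotient equals
   [f o]. *)
apply: (@regular_germ _ _ _ (fun z => (H z - f o * D z) * (d (z, z))^-1));
  last first.
  apply: regular_mul => //; apply: regular_sub => //; exact: regular_scale.
apply: (@filterS _ _ _ ([set z | d (z, z) != 0] `&` (U `&` V))); last first.
  by apply: filterI => //; apply: open_nbhs_nbhs; split=> //; exact: openI.
move=> z [dz [Uz Vz]] /=.
have rdz : regular z (fun y => d (y, z)) by exact: (tensor_slice_regular oU td).
have rfz : regular z (fun y => f (-' z +' y)).
  by apply: translate_regular; rewrite av_addN.
have -> : H z = v (fun y => f (-' z +' y) * d (y, z)) z.
  apply: esym; apply: vf_germ; first exact: regular_mul.
  have [ndz _] := locA rdz dz.
  apply: (@filterS _ _ _ ([set y | d (y, z) != 0] `&` U)); last first.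
    by apply: filterI => //; exact: open_nbhs_nbhs.
  move=> y [dy Uy]; have := FE (y, z) Uy Vz dy; rewrite /m /= => ->.
  by rewrite divfK.
by rewrite vf_leibniz // av_addN addrAC subrr add0r mulrAC divff // mul1r.
Qed.

(** Both sides are values, at [x] and at [t +' x], of the constant attached to the germ at the
    origin of [f (t +' x +' y)] in [y]. *)
Lemma vf_translate (t x : A) f : regular (t +' x) f ->
  v (fun y => f (t +' y)) x = v f (t +' x).
Proof.
move=> rf; have [|c vc] := @vf_at_origin_constant (fun y => f (t +' x +' y)).
  by apply: translate_regular; rewrite av_addr0.
transitivity c; [rewrite -(vc x) | rewrite -(vc (t +' x))]; congr (v _ _);
  apply: funext => y.
  by rewrite -av_addA av_addNKl.
by rewrite av_addNKl.
Qed.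

(** As [v] commutes with translations, the translate of [Y] by [-' t] is invariant too. *)
Lemma invariant_translate (Y V : set A) (t : A) g : Defs.invariant v Y ->
  open V -> regular_on V g -> (forall x, V x -> Y (t +' x) -> g x = 0) ->
  forall x, V x -> Y (t +' x) -> v g x = 0.
Proof.
move=> invY oV rg g0 x Vx Yx.
pose g' z := g (-' t +' z).
have rg' z : V (-' t +' z) -> regular z g'.
  by move=> Vz; apply: translate_regular; exact: rg.
transitivity (v (fun y => g' (t +' y)) x).
  by congr (v _ x); apply: funext => y; rewrite /g' av_addKl.
rewrite vf_translate; last by apply: rg'; rewrite av_addKl.
apply: (invY [set z | V (-' t +' z)]) => //.
- exact: (morphism_open (translate_morphism (-' t))).
- by move=> z Vz Yz; apply: g0; rewrite ?av_addNKl.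
- by rewrite /= av_addKl.
Qed.

Lemma regular_identity (V W : set A) g c : open V -> regular_on V g ->
  open W -> W !=set0 -> (forall x, W x -> g x = c) -> forall x, V x -> g x = c.
Proof.
move=> oV rg oW W0 gW x Vx; apply: contrapT => /eqP; rewrite -subr_eq0 => gx.
have [||y [[Vy +] Wy]] :=
  ivariety_openI _ oW _ W0 (U := [set x | V x /\ g x - c != 0]).
- apply: open_neq0 => // z Vz; apply: regular_add; first exact: rg.
  exact: regular_cst.
- by exists x.
- by rewrite gW // subrr eqxx.
Qed.

(** Such a [g] represents a first integral, so it is constant on some nonempty open set, and
    [regular_identity] extends this to [V]. *)
Lemma no_first_integral_constant :
  (~ exists f : ratfun A, nontrivial_first_integral v f) ->
  forall (V : set A) g, open V -> V !=set0 -> regular_on V g ->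
  (forall x, V x -> v g x = 0) -> exists c, forall x, V x -> g x = c.
Proof.
move=> noFI V g oV V0 rg vg; apply: contrapT => ncst; apply: noFI.
pose F := RatFrac oV V0 rg; exists (\pi_(ratfun A) F)%qT; split.
  move=> c /eqmodP/asboolP[W [oW W0 sW E]]; apply: ncst; exists c.
  exact: (regular_identity oV rg oW W0).
rewrite /first_integral ratfun_derE; apply/eqmodP/asboolP.
by exists V; split.
Qed.

(** * Shortest relations on an invariant set *)

Section Elimination.
Variable Y : set A.
Hypotheses (invY : Defs.invariant v Y) (Y0 : Y !=set0).
Hypothesis noFI : ~ exists f : ratfun A, nontrivial_first_integral v f.

(* A shortest nonzero tensor vanishing on [t + x \in Y], normalised so that some
   [g i = 1], is shortened by [v] acting on [x]; hence all [g i] are constants of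
   [v], and the tensor only depends on [t]. *)
Lemma tensor_vanish n (U V : set A) (f g : 'I_n -> A -> k) :
  open U -> open V ->
  (forall i, regular_on U (f i)) -> (forall i, regular_on V (g i)) ->
  (forall t x, U t -> V x -> Y (t +' x) -> \sum_i f i t * g i x = 0) ->
  forall t x, U t -> V x -> \sum_i f i t * g i x = 0.
Proof.
elim: n U V f g => [|n IHn] U V f g oU oV rf rg van t0 x0 Ut0 Vx0.
  by rewrite big_ord0.
apply: contrapT => /eqP nz.
(* A linear dependence would eliminate one [f j] and leave [n] terms, which vanish by induction. *)
have free c : (forall t, U t -> \sum_i c i * f i t = 0) -> forall i, c i = 0.
  move=> cf j; apply: contrapT => /eqP cj.
  pose f' i := f (lift j i).
  pose g' i x := g (lift j i) x - (c (lift j i) / c j) * g j x.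
  have E t x : U t -> \sum_i f i t * g i x = \sum_i f' i t * g' i x.
    move=> Ut; rewrite (bigD1_ord j) //=.
    have fj : f j t = - \sum_i f' i t * (c (lift j i) / c j).
      have := cf t Ut; rewrite (bigD1_ord j) //= => /eqP; rewrite addr_eq0 => /eqP e.
      apply: (mulfI cj); rewrite e mulrN mulr_sumr; congr (- _).
      by apply: eq_bigr => i _; rewrite mulrCA [c j * _]mulrC divfK // mulrC.
    rewrite fj mulNr mulr_suml addrC -sumrB; apply: eq_bigr => i _.
    by rewrite /g' mulrBr [in RHS]mulrA.
  move: nz; rewrite E // (IHn U V) ?eqxx // => [i|i|t x Ut Vx Yx].
  - exact: rf.
  - move=> x Vx; apply: regular_sub; first exact: rg.
    by apply: regular_scale; exact: rg.
  - by rewrite -E //; exact: van.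
have [i0 gi0] : exists i, g i x0 != 0.
  apply: contrapT => /forallNP g0; move: nz; rewrite big1 ?eqxx // => i _.
  by have /negP := g0 i; rewrite negbK => /eqP ->; rewrite mulr0.
pose V' := [set x | V x /\ g i0 x != 0].
have oV' : open V' by apply: open_neq0.
have V'x0 : V' x0 by [].
pose g' i x := g i x * (g i0 x)^-1.
have rg' i : regular_on V' (g' i).
  move=> x [Vx gx]; apply: regular_mul; first exact: rg.
  by have [] := locA (rg i0 x Vx) gx.
have vg'0 x : V' x -> v (g' i0) x = 0.
  move=> V'x; rewrite -(vf_cst v x 1); apply: vf_germ; first exact: rg'.
  apply: (@filterS _ _ _ V'); last exact: open_nbhs_nbhs.
  by move=> y [_ gy]; rewrite /g' divff.
have van' t x : U t -> V' x -> Y (t +' x) -> \sum_i f i t * g' i x = 0.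
  move=> Ut [Vx _] Yx; under eq_bigr do rewrite mulrA.
  by rewrite -mulr_suml van // mul0r.
(* Applying [v] in [x] kills the term [i0]; the other [n] terms still satisfy the vanishing
   condition, so their sum is 0 by induction and [free] gives each coefficient. *)
have vg' i x : V' x -> v (g' i) x = 0.
  move=> V'x; apply: (free (fun i => v (g' i) x)) => t Ut.
  transitivity (\sum_i f (lift i0 i) t * v (g' (lift i0 i)) x).
    rewrite (bigD1_ord i0) //= vg'0 // mul0r add0r.
    by apply: eq_bigr => j _; rewrite mulrC.
  apply: (IHn U V' (fun i => f (lift i0 i)) (fun i => v (g' (lift i0 i)))) => //.
    by move=> j z V'z; apply: vf_regular; exact: rg'.
  move=> s z Us V'z Yz.
  transitivity (v (fun x => \sum_i f i s * g' i x) z).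
    rewrite vf_sum => [|j]; last exact: rg'.
    by rewrite [RHS](bigD1_ord i0) //= vg'0 // mulr0 add0r.
  apply: (invariant_translate invY oV') V'z Yz => [y V'y|y V'y Yy].
    by apply: regular_sum => j; apply: regular_scale; exact: rg'.
  exact: van'.
have /choice[c gc] i : exists c, forall x, V' x -> g' i x = c.
  apply: (no_first_integral_constant noFI oV') => //; first by exists x0.
  exact: vg'.
pose b t := \sum_i c i * f i t.
have bE t x : V' x -> b t = \sum_i f i t * g' i x.
  by move=> V'x; apply: eq_bigr => i _; rewrite (gc i x V'x) mulrC.
have rb : regular_on U b.
  by move=> t Ut; apply: regular_sum => i; apply: regular_scale; exact: rf.
have [y0 Yy0] := Y0.
have oT : open [set t | V' (-' t +' y0)].
  apply: (morphism_open (f := fun t => -' t +' y0)) => //.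
  apply: morphism_add => //; [exact: av_opp_morphism | exact: morphism_cst].
(* By irreducibility some [t] has [b t != 0] and [-' t +' y0] in [V']; at that second point the sum
   is [b t], yet it vanishes because [y0] is in [Y]. *)
have [|||t [[Ut bt] V't]] := @ivariety_openI _ A [set t | U t /\ b t != 0] _ _ oT.
- exact: open_neq0.
- exists t0; split=> //; rewrite (bE t0 x0) //.
  under eq_bigr do rewrite mulrA.
  by rewrite -mulr_suml mulf_neq0 // invr_eq0.
(* The [t] for which [-' t +' y0] is [x0]. *)
- exists (y0 +' -' x0) => /=.
  have {2}-> : y0 = y0 +' -' x0 +' x0 by rewrite -av_addA av_addN av_addr0.
  by rewrite av_addKl.
- move: bt; rewrite (bE t _ V't) van' ?eqxx //.
  by rewrite av_addNKl.
Qed.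

Lemma invariant_full : closed Y -> Y = setT.
Proof.
move=> cY; apply/seteqP; split=> // z _; apply: contrapT => Yz.
have := morphism_open (av_add_morphism A) (closed_openC cY).
rewrite zprod_openE => /(_ (o, z))[]; first by rewrite /= av_add0.
move=> _ [[U [V [h [oU oV [I [f [g [rf rg hE]]]] ->]]]] [/= Uo Vz hz] sB].
have sumE t x : \sum_i f i t * g i x =
    \sum_(j < #|I|) f (enum_val j) t * g (enum_val j) x.
  by rewrite (reindex _ (onW_bij _ (@enum_val_bij I))).
(* The basic open set avoids [t +' x] in [Y], so [h] vanishes there; by [tensor_vanish] it is 0 at
   [(o, z)] as well. *)
move: hz; rewrite hE // sumE.
rewrite (tensor_vanish oU oV (fun j => rf (enum_val j))
  (fun j => rg (enum_val j))) ?eqxx //.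
move=> t x Ut Vx Yx; rewrite -sumE -hE //; apply: contrapT => /eqP htx.
by have /= := sB (t, x); apply.
Qed.

End Elimination.
End Translation.

(** * Wildness and the absence of rational first integrals *)

Theorem proposition5p2 (k : closedFieldType) (A : abelian_variety k)
    (v : vector_field A) :
  [pchar k]%R =i pred0 ->
  wild v <-> ~ exists f : ratfun A, nontrivial_first_integral v f.
Proof.
move=> char0; split=> [wildv [F [ncst intF]]|noFI [Y [cY Y0 /eqP YT invY]]];
  last first.
  by apply: YT; exact: (invariant_full invY).
apply: wildv; rewrite -[F]reprK in ncst intF.
move: intF; rewrite /first_integral ratfun_derE => /eqmodP/asboolP[W [oW W0 sW vF0]].
set f := ratval (repr F).
have rf : regular_on W f.
  move=> x /sW[Wx _]. exact: (@ratval_regular _ _ (repr F) x Wx).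
(* An attained value makes the level set nonempty. *)
have [x1 Wx1] := W0; pose c := f x1.
pose Z := [set x | W x /\ f x = c].
exists (closure Z); split.
- exact: closed_closure.
- by exists x1; apply: subset_closure.
(* A dense level set would meet the open locus [f - c != 0] unless this is empty, and then the
   integral is the constant [c]. *)
- apply/eqP => ZT; apply: (ncst c); apply/eqmodP/asboolP; exists W; split=> //.
  move=> x Wx /=; apply: contrapT => /eqP; rewrite -subr_eq0 => fx.
  have : closure Z x by rewrite ZT.
  move=> /(_ [set x | W x /\ f x - c != 0])[].
    apply: open_nbhs_nbhs; split=> //; apply: open_neq0 => //.
      exact: (prevariety_local (variety_prevariety A)).
    by move=> y Wy; apply: regular_add; [exact: rf | exact: regular_cst].
  by move=> y [[_ fy] [_]]; rewrite fy subrr eqxx.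
(* The locus [v g != 0] is open, so if it contained a point of the closure it would meet [Z] itself,
   where [invariant_level_set] applies. *)
- move=> U g oU rg gZ y Uy Zy; apply: contrapT => /eqP vgy.
  have := Zy [set x | U x /\ v g x != 0] => -[].
    apply: open_nbhs_nbhs; split=> //; apply: open_neq0 => //.
      exact: (prevariety_local (variety_prevariety A)).
    by move=> x Ux; apply: vf_regular; exact: rg.
  move=> x [[Wx fx] [Ux /eqP]]; apply.
  apply: (invariant_level_set char0 (variety_prevariety A) oW rf vF0 oU rg) Ux Wx fx.
  by move=> z Uz Wz fz; apply: gZ => //; apply: subset_closure.
Qed.
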